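(* Let $\Lambda$ be any ring and $f:A\twoheadrightarrow B$ an epimorphism of $\Lambda$-modules. The following conditions are equivalent: (1) $\underline{f}$ is an epimorphism in the stable category $\Lambda\text{-}\underline{\mathrm{Mod}}$; (2) every homomorphism $h:A\to Q$ with $Q$ projective is $f$-null; (3) every homomorphism $h:A\to Y$ of $\Lambda$-modules with $\underline{h}=0$ is $f$-null. If $\Lambda$ is left hereditary, then these conditions are equivalent to (4) every epimorphism $h:A\twoheadrightarrow Q$ with $Q$ projective is $f$-null.
   Context: Rings are associative with identity; modules are left modules. The stable category $\Lambda\text{-}\underline{\mathrm{Mod}}$ has all left $\Lambda$-modules as objects; its morphisms are classes $\underline{f}$ of $\Lambda$-homomorphisms $f$, where $f$ and $g$ are equivalent if $f-g$ factors through a projective module; thus $\underline{h}=0$ iff $h$ factors through a projective. Let $f:A\twoheadrightarrow B$ be an epimorphism of $\Lambda$-modules, with short exact sequence $[f]:\ 0\to\mathrm{Ker}\, f\to A\xrightarrow{f}B\to 0$. For $h:A\to Y$, form the pushout of $(f,h)$, giving $h':B\to D$ and the epimorphism $\pi:Y\to D$ with $h'f=\pi h$, and the short exact sequence $[\pi]:\ 0\to\mathrm{Ker}\,\pi\to Y\xrightarrow{\pi}D\to 0$. The maps (induced map $\mathrm{Ker}\, f\to\mathrm{Ker}\,\pi$, $h$, $h'$) form a chain map $[f]\to[\pi]$. We say (terminology introduced here) that $h$ is $f$-null if the following conditions, which are equivalent to each other for every $h$, hold: (i) this chain map $[f]\to[\pi]$ is null-homotopic; (ii) any chain map from $[f]$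 to a short exact sequence $0\to M\to Y\to N\to 0$ whose middle component is $h$ is null-homotopic; (iii) there is a homomorphism $s:B\to Y$ with $\pi s=h'$. *)

(* Defs.v *)
(* MathComp.  Rings are [pzRingType]s, so the zero ring is allowed. *)
From mathcomp Require Import all_boot all_order all_algebra.

Set Implicit Arguments.
Unset Strict Implicit.
Unset Printing Implicit Defensive.

Import GRing.Theory.
Local Open Scope ring_scope.

(* An epimorphism of modules is a surjective linear map. *)
Definition surjective (aT rT : Type) (g : aT -> rT) : Prop :=
  forall y, exists x, g x = y.

Section ModuleDefs.
Variable R : pzRingType.
Implicit Types A B C D M N P Q Y Z : lmodType R.

Definition projective P : Prop :=
  forall M N (g : {linear M -> N}) (k : {linear P -> N}),
    surjective g -> exists l : {linear P -> M}, g \o l =1 k.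

(* A left ideal of R is a submodule of the left regular module R^o. *)
Definition left_hereditary : Prop :=
  forall (S : {pred R^o}) (I : subLmodType S), projective I.

Definition factors_through_projective A B (h : A -> B) : Prop :=
  exists P, projective P /\
    exists (a : {linear A -> P}) (b : {linear P -> B}), h =1 b \o a.

(* Equality of the stable classes of u and v. *)
Definition stable_eq A B (u v : {linear A -> B}) : Prop :=
  factors_through_projective (u \- v).

(* Morphisms of the stable category are handled through representatives: this
   is right cancellability of the class of f. *)
Definition stable_epi A B (f : {linear A -> B}) : Prop :=
  forall Y (u v : {linear B -> Y}),
    stable_eq (u \o f) (v \o f) -> stable_eq u v.

Definition is_pushout A B Y D (f : {linear A -> B}) (h : {linear A -> Y})
    (h' : {linear B -> D}) (pi : {linear Y -> D}) : Prop :=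
  h' \o f =1 pi \o h /\
  forall Z (u : {linear B -> Z}) (v : {linear Y -> Z}), u \o f =1 v \o h ->
    exists w : {linear D -> Z},
      [/\ w \o h' =1 u, w \o pi =1 v &
          forall w' : {linear D -> Z},
            w' \o h' =1 u -> w' \o pi =1 v -> w' =1 w].

(* The choice of the pushout is immaterial, as it is unique up to isomorphism.
   The condition on s says that the chain map from 0 -> Ker f -> A -> B -> 0 to
   0 -> Ker pi -> Y -> D -> 0 with middle component h is null-homotopic. *)
Definition f_null A B Y (f : {linear A -> B}) (h : {linear A -> Y}) : Prop :=
  exists D (h' : {linear B -> D}) (pi : {linear Y -> D}),
    is_pushout f h h' pi /\ exists s : {linear B -> Y}, pi \o s =1 h'.

End ModuleDefs.

(* Main.v *)
(* For surjective f, the kernel of the pushout Y ->> D of (f, h) is h(Ker f),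
   so h is f-null iff some s : B -> Y satisfies (h - s f)(A) <= h(Ker f).
   (1) => (2): h' f = pi h factors through the projective module Q, so h'
   factors through a projective module, and hence lifts along pi.
   (2) => (3): if h = b a through a projective module and s works for a, then
   b s works for h.
   (3) => (1): if w f = b a with a : A -> P and s works for a, then w f = b s f,
   hence w = b s.
   (4) => (2): restrict h to its image, which is projective over a hereditary
   ring.  Indeed Q is a summand of a free module, so a submodule M of Q has
   jointly injective coordinates c_i : M -> R with finite supports.  A lift of
   M -> N along X ->> N is found by applying Zorn's lemma to the lifts defined
   on the submodules M_J of elements whose coordinates vanish off J. *)
From HB Require Import structures.
From mathcomp Require Import boolp classical_sets functions.
Require Import Defs.
From mathcomp Require Import all_boot all_order all_algebra.

Set Implicit Arguments.
Unset Strict Implicit.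
Unset Printing Implicit Defensive.

Import GRing.Theory.
Local Open Scope ring_scope.

Lemma linear_ext (R : pzRingType) (U V : lmodType R) (g : U -> V) :
  linear g -> exists G : {linear U -> V}, G =1 g.
Proof.
move=> lin_g.
pose G : {linear U -> V} := HB.pack g (GRing.isLinear.Build R U V *:%R g lin_g).
by exists G.
Qed.

(** * Submodules, quotients, images, and a pushout-free criterion for [f_null] *)

Section Submodules.
Variable R : pzRingType.
Implicit Types U V : lmodType R.

(** Membership is a [Prop], so that existential formulas define submodules directly;
    [submodule_pred] makes it boolean classically. *)
Record submodule V := Submodule {
  carrier :> V -> Prop;
  submodule0 : carrier 0;
  submoduleZD : forall a x y, carrier x -> carrier y -> carrier (a *: x + y) }.

Section Submodule.
Variables (V : lmodType R) (S : submodule V).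

Definition submodule_pred : {pred V} := fun x => `[< S x >].

Lemma submodule_predP : GRing.submod_closed submodule_pred.
Proof.
split; first exact/asboolP/submodule0.
by move=> a x y /asboolP Sx /asboolP Sy; apply/asboolP/submoduleZD.
Qed.

HB.instance Definition _ :=
  GRing.isSubmodClosed.Build R V submodule_pred submodule_predP.

Inductive submod := Submod x & x \in submodule_pred.
Definition submod_val u := let: Submod x _ := u in x.

HB.instance Definition _ := [isSub for submod_val].
HB.instance Definition _ := [Choice of submod by <:].
HB.instance Definition _ := [SubChoice_isSubLmodule of submod by <:].

Lemma submod_valP (u : submod) : S (val u).
Proof. by apply/asboolP/(valP u). Qed.

Lemma submod_insub x : S x -> {u : submod | val u = x}.
Proof.
move=> Sx; have Sx' : x \in submodule_pred by apply/asboolP.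
by exists (Submod Sx').
Qed.

Definition quotmod := Quotient.quot submodule_pred.
HB.instance Definition _ := Choice.on quotmod.
HB.instance Definition _ := EqQuotient.on quotmod.
HB.instance Definition _ := GRing.Zmodule.on quotmod.
HB.instance Definition _ := ZmodQuotient.on quotmod.

Local Open Scope quotient_scope.

Lemma quotmod_eq x y : \pi_quotmod x = \pi_quotmod y <-> S (x - y).
Proof.
split=> [/eqP|Sxy]; first by rewrite -Quotient.idealrBE => /asboolP.
by apply/eqP; rewrite -Quotient.idealrBE; apply/asboolP.
Qed.

Definition quotmod_scale (a : R) := lift_op1 quotmod ( *:%R a).

Lemma pi_scale a : {morph \pi_quotmod : x / a *: x >-> quotmod_scale a x}.
Proof.
move=> x; unlock quotmod_scale.
(* The added 0 gives the difference the combined shape [a *: x + y] of [submoduleZD]. *)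
apply/quotmod_eq; rewrite -scalerBr -[_ *: _]addr0.
apply: submoduleZD (submodule0 S).
by apply/quotmod_eq; rewrite reprK.
Qed.

Lemma piD : {morph \pi_quotmod : x y / x + y}.
Proof. by move=> x y; rewrite !piE. Qed.

Fact quotmod_scalerA a b v :
  quotmod_scale a (quotmod_scale b v) = quotmod_scale (a * b) v.
Proof. by rewrite -[v]reprK -!pi_scale scalerA. Qed.

Fact quotmod_scale1r : left_id 1 quotmod_scale.
Proof. by move=> v; rewrite -[v]reprK -!pi_scale scale1r. Qed.

Fact quotmod_scalerDr : right_distributive quotmod_scale +%R.
Proof.
move=> a u v; rewrite -[v]reprK -[u]reprK.
by rewrite -piD -!pi_scale -piD scalerDr.
Qed.

Fact quotmod_scalerDl v : {morph quotmod_scale^~ v : a b / a + b}.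
Proof. by move=> a b; rewrite -[v]reprK -!pi_scale -piD scalerDl. Qed.

HB.instance Definition _ := GRing.Zmodule_isLmodule.Build R quotmod
  quotmod_scalerA quotmod_scale1r quotmod_scalerDr quotmod_scalerDl.

Fact quotmod_pi_is_linear : linear \pi_quotmod.
Proof. by move=> a x y; rewrite piD pi_scale. Qed.

HB.instance Definition _ :=
  GRing.isLinear.Build R V quotmod *:%R \pi_quotmod quotmod_pi_is_linear.

End Submodule.

Lemma exists_cokernel V (S : submodule V) :
  exists (D : lmodType R) (p : {linear V -> D}),
    surjective p /\ forall y, p y = 0 <-> S y.
Proof.
exists (quotmod S), (\pi_(quotmod S))%qT; split=> [d|y].
  by exists (repr d); exact: reprK.
have := quotmod_eq S y 0; rewrite subr0 raddf0; exact.
Qed.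

Section Image.
Variables (U V : lmodType R) (phi : {linear U -> V}).

Fact image_submodule0 : exists x, phi x = 0.
Proof. by exists 0; rewrite raddf0. Qed.

Fact image_submoduleZD a y z : (exists x, phi x = y) -> (exists x, phi x = z) ->
  exists x, phi x = a *: y + z.
Proof. by move=> [x <-] [x' <-]; exists (a *: x + x'); rewrite linearP. Qed.

Definition image : submodule V := Submodule image_submodule0 image_submoduleZD.

Lemma image_corestrict : exists psi : {linear U -> submod image},
  surjective psi /\ forall u, val (psi u) = phi u.
Proof.
have imP u : image (phi u) by exists u.
pose g u := sval (submod_insub (imP u)).
have gE u : val (g u) = phi u by rewrite /g; case: submod_insub.
have lin_g : linear g.
  by move=> a x y; apply: val_inj; rewrite linearP /= !gE linearP.
have [psi psiE] := linear_ext lin_g; exists psi; split=> [w|u].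
  by have [u phiu] := submod_valP w; exists u; apply: val_inj; rewrite psiE gE.
by rewrite psiE.
Qed.

End Image.

Section KerImage.
Variables (A B Y : lmodType R) (f : {linear A -> B}) (h : {linear A -> Y}).

Fact ker_image_submodule0 : exists2 x, f x = 0 & h x = 0.
Proof. by exists 0; rewrite raddf0. Qed.

Fact ker_image_submoduleZD a y z :
  (exists2 x, f x = 0 & h x = y) -> (exists2 x, f x = 0 & h x = z) ->
  exists2 x, f x = 0 & h x = a *: y + z.
Proof.
move=> [x fx <-] [x' fx' <-].
by exists (a *: x + x'); rewrite linearP // fx fx' scaler0 addr0.
Qed.

Definition ker_image : submodule Y :=
  Submodule ker_image_submodule0 ker_image_submoduleZD.

End KerImage.

(** A chosen section [r] of [f] need not be linear, but [g \o r] is, since [g] depends only on the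
    value of [f]. *)
Lemma linear_factor (A B Z : lmodType R) (f : {linear A -> B})
    (g : {linear A -> Z}) :
  surjective f -> (forall a, f a = 0 -> g a = 0) ->
  exists g' : {linear B -> Z}, g' \o f =1 g.
Proof.
move=> surj_f ker_fg.
pose r b := sval (cid (surj_f b)).
have rK b : f (r b) = b by rewrite /r; case: cid.
have eq_g a a' : f a = f a' -> g a = g a'.
  move=> eq_f; apply/eqP; rewrite -subr_eq0 -raddfB; apply/eqP/ker_fg.
  by rewrite linearB eq_f subrr.
have lin : linear (g \o r).
  by move=> a x y /=; rewrite -linearP; apply: eq_g; rewrite linearP !rK.
have [g' g'E] := linear_ext lin.
by exists g' => a /=; rewrite g'E /=; apply: eq_g.
Qed.

Lemma f_nullP (A B Y : lmodType R) (f : {linear A -> B}) (h : {linear A -> Y}) :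
  surjective f ->
  f_null f h <-> exists s : {linear B -> Y},
    forall a, exists2 k, f k = 0 & h k = h a - s (f a).
Proof.
move=> surj_f.
have [D [p [surj_p kerp]]] := exists_cokernel (ker_image f h).
have kerph a : f a = 0 -> (p \o h) a = 0 by move=> fa0; apply/kerp; exists a.
have [h' h'E] := linear_factor (g := p \o h) surj_f kerph.
split=> [[D1 [h1 [p1 [[comm univ] [s sE]]]]]|[s sP]].
  (* The universal property of the given pushout [D1] yields [w : D1 -> D] with [w p1 = p]; it
     carries [p1 s = h1] to a statement about the kernel of [p]. *)
  exists s => a; have [w [_ wp _]] := univ _ _ _ h'E.
  have commE : h1 (f a) = p1 (h a) := comm a.
  have psE : p1 (s (f a)) = h1 (f a) := sE (f a).
  apply/(kerp (h a - s (f a))).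
  by rewrite -wp /= linearB psE commE subrr raddf0.
exists D, h', p; split; last first.
  exists s => b; have [a <-] := surj_f b; have /= -> := h'E a.
  by apply/eqP; rewrite eq_sym -subr_eq0 -linearB; apply/eqP/kerp/sP.
(* The cokernel [D] is a pushout: [v] kills [h(Ker f)] because [v h = u f], so it factors through
   [p], uniquely as [p] is onto. *)
split=> // Z u v uv.
have uvE a : u (f a) = v (h a) := uv a.
have kerv y : p y = 0 -> v y = 0.
  by case/kerp=> a fa0 <-; rewrite -uvE fa0 raddf0.
have [w wE] := linear_factor surj_p kerv.
have wpE y : w (p y) = v y := wE y.
have h'fE a : h' (f a) = p (h a) := h'E a.
exists w; split=> // [b|w' _ w'E d].
  by have [a <-] := surj_f b; rewrite /= h'fE wpE uvE.
by have [y <-] := surj_p d; rewrite wpE -w'E.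
Qed.

End Submodules.

(** * Free modules as finitely supported functions *)

Section FreeModule.
Variables (R : pzRingType) (T : choiceType).

Definition finite_support (f : T -> R^o) : Prop :=
  exists s : seq T, forall t, f t != 0 -> t \in s.

Fact finite_support0 : finite_support 0.
Proof. by exists [::] => t; rewrite eqxx. Qed.

Fact finite_supportZD a f g :
  finite_support f -> finite_support g -> finite_support (a *: f + g).
Proof.
move=> [s fs] [s' gs']; exists (s ++ s') => t; rewrite !fctE mem_cat => nz.
have [ft0|/fs -> //] := eqVneq (f t) 0.
by rewrite gs' ?orbT //; apply: contra_neq nz => ->; rewrite ft0 scaler0 addr0.
Qed.

Definition free_submodule : submodule (T -> R^o) :=
  Submodule finite_support0 finite_supportZD.

Definition free_module := submod free_submodule.

(** Makes evaluation independent of the list chosen to cover the support, so that linearity can be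
    checked over one common list. *)
Lemma sum_support (Q : lmodType R) (q : T -> Q) (f : T -> R^o) (s s' : seq T) :
  (forall t, f t != 0 -> t \in s) -> (forall t, f t != 0 -> t \in s') ->
  \sum_(t <- undup s) (f t : R) *: q t = \sum_(t <- undup s') (f t : R) *: q t.
Proof.
have restrict r : \sum_(t <- undup r) (f t : R) *: q t =
    \sum_(t <- [seq t <- undup r | f t != 0]) (f t : R) *: q t.
  rewrite big_filter [RHS]big_mkcond; apply: eq_bigr => t _.
  by case: eqVneq => // ->; rewrite scale0r.
move=> fs fs'; rewrite restrict [RHS]restrict; apply: perm_big.
apply: uniq_perm; rewrite ?filter_uniq ?undup_uniq // => t.
by rewrite !mem_filter !mem_undup; case: eqP => //= /eqP nz; rewrite fs ?fs'.
Qed.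

Lemma free_module_eval (Q : lmodType R) (q : T -> Q) :
  exists ev : {linear free_module -> Q}, forall t, exists x, ev x = q t.
Proof.
pose supp (x : free_module) := sval (cid (submod_valP x)).
have suppP x t : val x t != 0 -> t \in supp x.
  by rewrite /supp; case: cid => r rP; exact: rP.
pose e x := \sum_(t <- undup (supp x)) (val x t : R) *: q t.
have lin_e : linear e.
  move=> a x y; pose s := supp x ++ supp y ++ supp (a *: x + y).
  rewrite /e (@sum_support _ _ (val x) _ s); first last.
  - by move=> t /suppP; rewrite !mem_cat => ->.
  - exact: suppP.
  rewrite (@sum_support _ _ (val y) _ s); first last.
  - by move=> t /suppP; rewrite !mem_cat => ->; rewrite orbT.
  - exact: suppP.
  rewrite (@sum_support _ _ (val (a *: x + y)) _ s); first last.
  - by move=> t /suppP; rewrite !mem_cat => ->; rewrite !orbT.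
  - exact: suppP.
  rewrite scaler_sumr -big_split; apply: eq_bigr => t _ /=.
  by rewrite scalerA -scalerDl.
have [ev evE] := linear_ext lin_e; exists ev => t.
(* The basis vector at [t], which evaluates to [q t]. *)
pose d := (fun t' => (t' == t)%:R) : T -> R^o.
have sd t' : d t' != 0 -> t' \in [:: t].
  by rewrite inE /d; case: (t' == t); rewrite ?eqxx.
have [x xE] : {x : free_module | val x = d}.
  by apply: submod_insub; exists [:: t].
exists x; rewrite evE /e (@sum_support _ _ (val x) _ [:: t]); first last.
- by rewrite xE.
- exact: suppP.
by rewrite /= big_seq1 xE /d eqxx scale1r.
Qed.

End FreeModule.

(** * Coordinates on projective modules *)

Section Projective.
Variable R : pzRingType.

(** Unlike a dual basis, which also has vectors in [M], such a system restricts to every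
    submodule. *)
Definition coordinate_system (M : lmodType R) (I : choiceType)
    (c : I -> {linear M -> R^o}) : Prop :=
  (forall x, exists s : seq I, forall i, c i x != 0 -> i \in s) /\
  (forall x, (forall i, c i x = 0) -> x = 0).

Lemma projective_section (P E : lmodType R) (p : {linear E -> P}) :
  projective P -> surjective p -> exists s : {linear P -> E}, cancel s p.
Proof. by move=> projP surj_p; apply: (projP _ _ p idfun surj_p). Qed.

(** A section of the evaluation map embeds [P] in the free module on its own elements; the
    components of this embedding are the coordinates. *)
Lemma projective_coordinates (P : lmodType R) :
  projective P -> exists c : P -> {linear P -> R^o}, coordinate_system c.
Proof.
move=> projP; have [ev evP] := free_module_eval (fun x : P => x).
have [s sK] := projective_section projP evP.
have lin_coord t : linear (fun x => val (s x) t : R^o).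
  by move=> a x y; rewrite !linearP.
pose c t := sval (cid (linear_ext (lin_coord t))).
have cE t x : c t x = val (s x) t by rewrite /c; case: cid.
exists c; split=> [x|x c0].
  by have [l lP] := submod_valP (s x); exists l => t; rewrite cE; apply: lP.
rewrite -[x]sK; suff -> : s x = 0 by rewrite raddf0.
by apply: val_inj; rewrite raddf0; apply/funext => t; rewrite -cE c0.
Qed.

End Projective.

(** * Submodules of projectives over a left hereditary ring *)

Section Hereditary.
Variable R : pzRingType.
Hypothesis hered : left_hereditary R.

Section Lift.
Variables (M X N : lmodType R) (g : {linear X -> N}) (k : {linear M -> N}).
Variables (I : choiceType) (c : I -> {linear M -> R^o}).
Hypothesis surj_g : surjective g.
Hypothesis coord_c : coordinate_system c.

Definition vanishes_off (J : set I) (x : M) : Prop :=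
  forall i, ~ J i -> c i x = 0.

Fact vanishes_off0 J : vanishes_off J 0.
Proof. by move=> i _; rewrite raddf0. Qed.

Fact vanishes_offZD J a x y :
  vanishes_off J x -> vanishes_off J y -> vanishes_off J (a *: x + y).
Proof. by move=> x0 y0 i Ji; rewrite linearP x0 // y0 // scaler0 addr0. Qed.

Definition vanishing J : submodule M :=
  Submodule (@vanishes_off0 J) (@vanishes_offZD J).

Lemma vanishing_sub (J J' : set I) x :
  (J `<=` J')%classic -> vanishing J x -> vanishing J' x.
Proof. by move=> JJ' x0 i J'i; apply: x0 => /JJ'. Qed.

(* The values of [lift_fun] outside [vanishing lift_dom] are irrelevant. *)
Record partial_lift := PartialLift {
  lift_dom : set I;
  lift_fun : M -> X;
  lift_funZD : forall a x y, vanishing lift_dom x -> vanishing lift_dom y ->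
    lift_fun (a *: x + y) = a *: lift_fun x + lift_fun y;
  lift_funP : forall x, vanishing lift_dom x -> g (lift_fun x) = k x }.

Definition lift_extends (p q : partial_lift) : Prop :=
  (lift_dom p `<=` lift_dom q)%classic /\
  forall x, vanishing (lift_dom p) x -> lift_fun q x = lift_fun p x.

Lemma lift_extends_refl p : lift_extends p p.
Proof. by split=> [i|]. Qed.

Lemma lift_extends_trans p q r :
  lift_extends p q -> lift_extends q r -> lift_extends p r.
Proof.
move=> [Dpq Fpq] [Dqr Fqr]; split=> [i /Dpq /Dqr //|x px].
by rewrite Fqr ?Fpq //; apply: vanishing_sub px.
Qed.

(** By joint injectivity only 0 has all coordinates zero, so the zero function is a lift there. *)
Lemma empty_lift : exists p : partial_lift, lift_dom p = classical_sets.set0.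
Proof.
have van0 x : vanishing classical_sets.set0 x -> x = 0.
  by move=> x0; apply: coord_c.2 => i; apply: x0.
have ZD a x y : vanishing classical_sets.set0 x ->
    vanishing classical_sets.set0 y -> (0 : X) = a *: 0 + 0 by rewrite scaler0 addr0.
have P x : vanishing classical_sets.set0 x -> g 0 = k x.
  by move/van0->; rewrite !raddf0.
by exists (@PartialLift classical_sets.set0 (fun=> 0) ZD P).
Qed.

Lemma chain_lift (C : set partial_lift) :
  total_on C (fun p q => lift_extends p q) ->
  exists q, forall p, C p -> lift_extends p q.
Proof.
(* The empty chain is bounded separately, as [capture] starts from a member of [C]. *)
move=> totC; have [p0|C0] := pselect (exists p, C p); last first.
  by have [p _] := empty_lift; exists p => q Cq; case: C0; exists q.
pose D : set I := fun i => exists2 p, C p & lift_dom p i.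
have capture (s : seq I) : (forall i, i \in s -> D i) ->
    exists2 p, C p & forall i, i \in s -> lift_dom p i.
  elim: s => [_|i s IHs sD]; first by have [p Cp] := p0; exists p.
  have [p Cp ps] : exists2 p, C p & forall i, i \in s -> lift_dom p i.
    by apply: IHs => j sj; apply: sD; rewrite inE sj orbT.
  have [q Cq qi] := sD i (mem_head _ _).
  have [[pq _]|[qp _]] := totC _ _ Cp Cq.
    by exists q => // j; rewrite inE => /predU1P[->|/ps/pq].
  by exists p => // j; rewrite inE => /predU1P[->|/ps //]; apply: qp.
have van x : vanishing D x -> exists2 p, C p & vanishing (lift_dom p) x.
  move=> x0; have [s sP] := coord_c.1 x.
  (* The list [s] may contain indices outside [D]; filtering keeps the true support of [x], which
     lies in [D] and hence in one member of the chain. *)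
  have [|p Cp ps] := @capture [seq i <- s | c i x != 0].
    move=> i; rewrite mem_filter => /andP[nz _].
    by apply: contrapT => /x0 /eqP; rewrite (negPf nz).
  exists p => // i pi; apply/eqP/negP => /negP nz; apply: pi; apply: ps.
  by rewrite mem_filter nz sP.
(* Members of the chain agree wherever two of them apply, so the chosen one does not matter; the
   default 0 is taken only outside [vanishing D]. *)
pose l x := if pselect (exists2 p, C p & vanishing (lift_dom p) x) is left e
  then lift_fun (s2val (cid2 e)) x else 0.
have lE p x : C p -> vanishing (lift_dom p) x -> l x = lift_fun p x.
  rewrite /l => Cp px; case: pselect => [e|[]]; last by exists p.
  case: cid2 => q Cq qx /=.
  by have [[_ ->]|[_ ->]] := totC _ _ Cp Cq.
have van2 x y : vanishing D x -> vanishing D y -> exists p,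
    [/\ C p, vanishing (lift_dom p) x & vanishing (lift_dom p) y].
  move=> /van[p Cp px] /van[q Cq qy].
  have [[pq _]|[qp _]] := totC _ _ Cp Cq.
    by exists q; split=> //; apply: vanishing_sub px.
  by exists p; split=> //; apply: vanishing_sub qy.
have ZD a x y : vanishing D x -> vanishing D y ->
    l (a *: x + y) = a *: l x + l y.
  move=> Dx Dy; have [p [Cp px py]] := van2 x y Dx Dy.
  by rewrite !(lE p) //; [apply: lift_funZD | apply: submoduleZD].
have P x : vanishing D x -> g (l x) = k x.
  by move=> /van[p Cp px]; rewrite (lE p) //; apply: lift_funP.
exists (PartialLift ZD P) => p Cp; split=> [i pi|x px]; first by exists p.
exact: lE.
Qed.

Lemma one_step_lift p i : exists2 q, lift_extends p q & lift_dom q i.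
Proof.
have [pi|p'i] := pselect (lift_dom p i).
  by exists p; first exact: lift_extends_refl.
pose J := lift_dom p; pose J' : set I := fun j => J j \/ j = i.
(* [c i] maps [vanishing J'] onto a left ideal with kernel [vanishing J]; as
   the ideal is projective, this surjection splits. *)
have JJ' : (J `<=` J')%classic by move=> j; left.
have lin_ci : linear (fun u : submod (vanishing J') => c i (val u)).
  by move=> a u v; rewrite !linearP.
have [phi phiE] := linear_ext lin_ci.
have [psi [surj_psi psiE]] := image_corestrict phi.
have projW : projective (submod (image phi)) by apply: hered.
have [sigma sigmaK] := projective_section projW surj_psi.
(* Projectivity of the ideal is used a second time: [lam] lifts [k] on the image of [sigma], a
   complement of [vanishing J] in [vanishing J']. *)
have lin_ks : linear (fun w => k (val (sigma w))).
  by move=> a u v; rewrite !linearP.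
have [ks ksE] := linear_ext lin_ks.
have [lam lamE] := projW _ _ g ks surj_g.
(* Coordinate [i] cancels because [sigma] splits [psi]; any other index outside [J] is also outside
   [J']. *)
have vanB u : vanishing J (val (u - sigma (psi u))).
  move=> j Jj; have [->|ji] := eqVneq j i; last first.
    by apply: (submod_valP (u - sigma (psi u))) => -[//|/eqP]; apply/negP.
  by rewrite -phiE -psiE linearB sigmaK subrr.
(* The old lift handles the component in [vanishing J], and [lam] handles the component
   [sigma (psi u)]. *)
pose l' u := lift_fun p (val (u - sigma (psi u))) + lam (psi u).
pose l x := l' (insubd 0 x).
have lE x (u : submod (vanishing J')) : val u = x -> l x = l' u.
  by move=> <-; rewrite /l valKd.
have ZD a x y : vanishing J' x -> vanishing J' y ->
    l (a *: x + y) = a *: l x + l y.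
  move=> /submod_insub[u uE] /submod_insub[v vE].
  rewrite (lE x u) // (lE y v) // (lE _ (a *: u + v)); last first.
    by rewrite linearP /= uE vE.
  rewrite /l' scalerDr addrACA -lift_funZD // linearP; congr (lift_fun p _ + _).
    by rewrite (linearP sigma) opprD addrACA -scalerBr.
  by rewrite linearP.
have P x : vanishing J' x -> g (l x) = k x.
  move=> /submod_insub[u <-]; rewrite (lE _ u) // /l' linearD.
  have /= -> := lamE (psi u).
  rewrite ksE (lift_funP (vanB u)) /= linearB /=.
  by rewrite subrK.
exists (PartialLift ZD P); last by right.
split=> // x Jx /=.
have [u uE] := submod_insub (vanishing_sub JJ' Jx).
have psi0 : psi u = 0.
  by apply: val_inj; rewrite psiE phiE uE Jx // raddf0.
by rewrite (lE _ u uE) /l' psi0 !raddf0 !addr0 uE.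
Qed.

Lemma coordinates_lift : exists l : {linear M -> X}, g \o l =1 k.
Proof.
have [p0 _] := empty_lift.
(* Zorn's lemma is taken for preorders: lifts that differ only in their irrelevant values extend
   each other. *)
have [||C totC|p maxp] :=
  @ZL_preorder partial_lift p0 (fun p q => `[< lift_extends p q >]).
- by move=> p; apply/asboolP/lift_extends_refl.
- move=> q p r /asboolP pq /asboolP qr.
  by apply/asboolP/(lift_extends_trans pq).
- have [|q qP] := @chain_lift C; last by exists q => p /qP/asboolP.
  by move=> p q Cp Cq; have [/asboolP|/asboolP] := totC _ _ Cp Cq; [left|right].
(* A maximal lift has every index in its domain, since a one-step extension must be extended by [p]
   in return. *)
have full x : vanishing (lift_dom p) x.
  move=> i []; have [q /asboolP pq qi] := one_step_lift p i.
  by have /asboolP[qp _] := maxp q pq; apply: qp.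
have lin : linear (lift_fun p) by move=> a x y; apply: lift_funZD.
have [l lE] := linear_ext lin; exists l => x /=.
by rewrite lE lift_funP.
Qed.

End Lift.

(** The coordinates of [Q] restrict to [S], which is all that the lifting argument requires. *)
Lemma hereditary_submodule (Q : lmodType R) (S : submodule Q) :
  projective Q -> projective (submod S).
Proof.
move=> /projective_coordinates[c [fin_c inj_c]] X N g k surj_g.
have lin_c q : linear (fun u : submod S => c q (val u)).
  by move=> a u v; rewrite !linearP.
pose d q := sval (cid (linear_ext (lin_c q))).
have dE q u : d q u = c q (val u) by rewrite /d; case: cid.
apply: (coordinates_lift k surj_g (c := d)); split=> [u|u du].
  have [s sP] := fin_c (val u); exists s => q; rewrite dE; exact: sP.
by apply: val_inj; rewrite raddf0; apply: inj_c => q; rewrite -dE.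
Qed.

End Hereditary.

Theorem theorem5p7 (R : pzRingType) (A B : lmodType R) (f : {linear A -> B})
    (hf : surjective f) :
  let c1 := stable_epi f in
  let c2 := forall (Q : lmodType R) (h : {linear A -> Q}),
    projective Q -> f_null f h in
  let c3 := forall (Y : lmodType R) (h : {linear A -> Y}),
    stable_eq h \0 -> f_null f h in
  let c4 := forall (Q : lmodType R) (h : {linear A -> Q}),
    projective Q -> surjective h -> f_null f h in
  [<-> c1; c2; c3] /\ (left_hereditary R -> [<-> c1; c2; c3; c4]).
Proof.
move=> c1 c2 c3 c4.
have c12 : c1 -> c2.
  move=> epi_f Q h projQ; apply/(f_nullP _ hf).
  have [D [p [surj_p kerp]]] := exists_cokernel (ker_image f h).
  have kerph a : f a = 0 -> (p \o h) a = 0 by move=> fa0; apply/kerp; exists a.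
  have [h' h'E] := linear_factor (g := p \o h) hf kerph.
  (* Comparing [h'] with the zero map: their difference after [f] is [p h], which passes through
     [Q]. *)
  have [|P [projP [a [b abE]]]] := epi_f D h' \0.
    by exists Q; split=> //; exists h, p => x /=; rewrite subr0; apply: h'E.
  have [b' b'E] := projP _ _ p b surj_p.
  exists (b' \o a) => x; apply/kerp; rewrite linearB /=.
  have /= <- := h'E x; have /= -> := b'E (a (f x)).
  by have /= <- := abE (f x); rewrite subr0 subrr.
have c23 : c2 -> c3.
  move=> null_f Y h [P [projP [a [b abE]]]]; apply/(f_nullP _ hf).
  have hE x : h x = b (a x) by have /= <- := abE x; rewrite subr0.
  have /(f_nullP _ hf)[s sP] := null_f P a projP.
  exists (b \o s) => x; have [k fk0 ak] := sP x.
  by exists k => //; rewrite !hE ak linearB.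
have c31 : c3 -> c1.
  move=> null_f Y u v [P [projP [a [b abE]]]]; exists P; split=> //.
  (* The map [a] is itself stably zero, through the identity of [P]. *)
  have /(f_nullP _ hf)[s sP] : f_null f a.
    apply: null_f; exists P; split=> //; exists a, idfun => x /=.
    by rewrite subr0.
  exists s, b => y; have [x <-] := hf y; have [k fk0 ak] := sP x.
  (* Since [b a = (u - v) f] kills [k], applying [b] to [a k = a x - s (f x)] gives
     [(u - v) y = b (s y)]. *)
  have baE z : b (a z) = u (f z) - v (f z) by have /= <- := abE z.
  apply/eqP; rewrite /= -baE -subr_eq0 -linearB -ak baE fk0.
  by rewrite !raddf0 addr0.
have c34 : c3 -> c4 by move=> /c31 /c12 h2 Q h projQ _; apply: h2.
split=> [|hered]; first by tfae.
tfae=> // null_f; apply/c31/c23 => Q h projQ; apply/(f_nullP _ hf).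
(* A map [s] for the corestriction [h1], followed by the inclusion [j], serves for [h] with the same
   [k]. *)
have [h1 [surj_h1 h1E]] := image_corestrict h.
have /(f_nullP _ hf)[s sP] : f_null f h1.
  by apply: null_f => //; apply: hereditary_submodule.
have [j jE] : exists j : {linear submod (image h) -> Q}, j =1 val.
  by apply: linear_ext => a x y; rewrite linearP.
exists (j \o s) => x; have [k fk0 h1k] := sP x.
by exists k => //; rewrite -!h1E h1k /= jE.
Qed.
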